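(* If $G$ is a connected graph having $n\geq 3$ vertices, then \[\frac{1536}{343}\,X(G)\leq AZI(G)\leq\frac{\sqrt{(n-1)^{13}}}{\sqrt{32}\,(n-2)^{3}}\,X(G),\] with left equality if and only if $G\cong S_{1,8}$ and right equality if and only if $G\cong K_{n}$.
   Context: Graphs are finite and simple, with vertex set $V(G)=\{v_1,\dots,v_n\}$ and edge set $E(G)$. $d_i$ is the degree of the vertex $v_i$, and $ij$ denotes the edge joining $v_i$ and $v_j$. The sum-connectivity index is $X(G)=\sum_{ij\in E(G)}\frac{1}{\sqrt{d_i+d_j}}$ and the augmented Zagreb index is $AZI(G)=\sum_{ij\in E(G)}\left(\frac{d_id_j}{d_i+d_j-2}\right)^{3}$. $K_k$ denotes the complete graph on $k$ vertices, and $S_{1,8}$ denotes the star with one central vertex joined to $8$ pendent vertices (so it has $9$ vertices). *)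

(* Defs.v *)
From mathcomp Require Import all_boot all_order all_algebra.

Set Implicit Arguments.
Unset Strict Implicit.
Unset Printing Implicit Defensive.

Import Order.TTheory GRing.Theory Num.Theory.
Local Open Scope ring_scope.

Record sgraph := SGraph {
  vertex :> finType;
  adj : rel vertex;
  adj_sym : symmetric adj;
  adj_irrefl : irreflexive adj
}.

Definition degree (G : sgraph) (v : G) : nat := #|[set w | adj v w]|.

(* The edge joining v and w is the unordered pair {v, w}, so each edge
   occurs exactly once in the sums over [edges G]. *)
Definition edges (G : sgraph) : {set {set G}} :=
  [set [set p.1; p.2] | p : G * G & adj p.1 p.2].

Definition connected_graph (G : sgraph) : Prop :=
  (0 < #|G|)%N /\ forall v w : G, connect (@adj G) v w.

Definition graph_iso (G H : sgraph) : Prop :=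
  exists2 f : G -> H, bijective f &
    forall v w : G, adj (f v) (f w) = adj v w.

(* For an edge e = {i, j}, the sum over v in e is d_i + d_j and the product
   over v in e is d_i d_j, since i and j are distinct. *)
Definition sum_connectivity (R : rcfType) (G : sgraph) : R :=
  \sum_(e in edges G) 1 / Num.sqrt (\sum_(v in e) (degree v)%:R).

Definition augmented_zagreb (R : rcfType) (G : sgraph) : R :=
  \sum_(e in edges G)
    ((\prod_(v in e) (degree v)%:R) /
     ((\sum_(v in e) (degree v)%:R) - 2)) ^+ 3.

Definition complete_adj (k : nat) : rel 'I_k := fun i j => i != j.

Lemma complete_adj_sym k : symmetric (@complete_adj k).
Proof. by move=> i j; rewrite /complete_adj eq_sym. Qed.

Lemma complete_adj_irrefl k : irreflexive (@complete_adj k).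
Proof. by move=> i; rewrite /complete_adj eqxx. Qed.

Definition complete_graph (k : nat) : sgraph :=
  SGraph (@complete_adj_sym k) (@complete_adj_irrefl k).

(* The center is ord0; exactly one endpoint of each edge is the center. *)
Definition star_adj (k : nat) : rel 'I_k.+1 :=
  fun i j => (i == ord0) (+) (j == ord0).

Lemma star_adj_sym k : symmetric (@star_adj k).
Proof. by move=> i j; rewrite /star_adj addbC. Qed.

Lemma star_adj_irrefl k : irreflexive (@star_adj k).
Proof. by move=> i; rewrite /star_adj addbb. Qed.

(* S_{1,k}, on k + 1 vertices. *)
Definition star_graph (k : nat) : sgraph :=
  SGraph (@star_adj_sym k) (@star_adj_irrefl k).

(* Main.v *)
Require Import Defs.
From mathcomp Require Import all_boot all_order all_algebra.
From mathcomp Require Import perm ring lra.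

(** Both inequalities hold edge by edge. For an edge whose ends have degrees
    [i] and [j], the ratio of its augmented Zagreb term to its
    sum-connectivity term is
      f(i, j) = (i j / (i + j - 2))^3 sqrt (i + j),
    so it is enough to find the extrema of f on the degree pairs that occur.
    In a connected graph on at least three vertices one end of each edge has
    degree at least 2; f is symmetric, so [2 <= j] may be assumed.

    Lower bound. If both degrees are at least 2, then i j / (i + j - 2) >= 2
    and f is at least 16, far above 1536/343. If i = 1, put
    u = 7 j / (8 (j - 1)), which is 1 exactly at j = 8. The squared claim
    reads u^6 (j + 1) >= 9, and the Bernoulli bound u^6 >= 6 u - 5 leaves
      (6 u - 5) (j + 1) - 9 = (j - 8) (j - 7) / (4 (j - 1)),
    which is nonnegative because j is an integer
    ([pendent_term_ge9], [edge_term_lower]). Integrality matters: the real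
    minimum of f(1, j) lies strictly between 7 and 8.

    Upper bound. With d = n - 1 the largest possible degree, both factors of
    f are maximal at (d, d), and sqrt (i + j) is maximal only there
    ([zagreb_ratio_le_max], [edge_term_upper]).

    Equality of the two sums forces equality on each edge. On the left, every
    edge then joins a vertex of degree 1 to one of degree 8; the leaves around
    a vertex of degree 8 have no other neighbours, so by connectedness the
    graph is a star ([star_of_edge_degrees]). On the right, every vertex, being
    on some edge, has degree n - 1, so the graph is complete
    ([complete_iff_edge_degrees]). *)

Set Implicit Arguments.
Unset Strict Implicit.
Unset Printing Implicit Defensive.

Import Order.TTheory GRing.Theory Num.Theory.
Local Open Scope ring_scope.

(** * Extrema of the edge terms *)

Section EdgeTerms.
Variable R : rcfType.
Implicit Types c s t u x y m : R.

(** Squaring removes the square root from the comparison of two edge terms,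
    so that only rational functions of the degrees remain. *)
Lemma leif_div_sqrt c s t C : 0 <= c -> 0 < s -> 0 <= t ->
  c ^+ 2 <= t ^+ 2 * s ?= iff C -> c * (1 / Num.sqrt s) <= t ?= iff C.
Proof.
move=> c0 s0 t0 [le eq].
have q0 : 0 < Num.sqrt s by rewrite sqrtr_gt0.
have ts0 : 0 <= t * Num.sqrt s by rewrite mulr_ge0 // ltW.
have e : t ^+ 2 * s = (t * Num.sqrt s) ^+ 2 by rewrite exprMn sqr_sqrtr // ltW.
rewrite e in le eq; rewrite mul1r; split.
  by rewrite ler_pdivrMr // -ler_sqr.
by rewrite -eq eqrXn2 // -subr_eq0 -[RHS]subr_eq0 -(mulIr_eq0 _ (mulIf (lt0r_neq0 q0)))
  mulrBl mulfVK // lt0r_neq0.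
Qed.

Lemma geif_div_sqrt c s t C : 0 <= c -> 0 < s -> 0 <= t ->
  t ^+ 2 * s <= c ^+ 2 ?= iff C -> t <= c * (1 / Num.sqrt s) ?= iff C.
Proof.
move=> c0 s0 t0 [le eq].
have q0 : 0 < Num.sqrt s by rewrite sqrtr_gt0.
have ts0 : 0 <= t * Num.sqrt s by rewrite mulr_ge0 // ltW.
have e : t ^+ 2 * s = (t * Num.sqrt s) ^+ 2 by rewrite exprMn sqr_sqrtr // ltW.
rewrite e in le eq; rewrite mul1r; split.
  by rewrite ler_pdivlMr // -ler_sqr.
by rewrite -eq eqrXn2 // eq_sym -subr_eq0 -[RHS]subr_eq0
  -(mulIr_eq0 _ (mulIf (lt0r_neq0 q0))) mulrBl mulfVK ?lt0r_neq0 // -oppr_eq0 opprB.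
Qed.

(** The hypotheses are asymmetric so that the edges at a leaf, [x = 1], are
    covered together with all others. *)
Lemma zagreb_ratio_le_max x y m : 0 <= x <= m -> 2 <= y <= m -> 0 < x + y - 2 ->
  2 <= m -> x * y / (x + y - 2) <= m ^+ 2 / (2 * (m - 1)).
Proof.
move=> /andP[x0 xm] /andP[y2 ym] s0 m2.
rewrite ler_pdivlMr; last lra.
rewrite mulrAC ler_pdivrMr //.
rewrite -subr_ge0.
(* The difference of the cross products is affine in [y]; this is its
   interpolation between [y = 2] and [y = m], where its values are
   [x * (m - 2) ^+ 2] and [m * (m - 2) * (m - x)]. *)
have -> : m ^+ 2 * (x + y - 2) - x * y * (2 * (m - 1))
   = (m - y) * x * (m - 2) + (y - 2) * m * (m - x) by ring.
by rewrite addr_ge0 ?mulr_ge0; lra.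
Qed.

Lemma zagreb_ratio_ge2 x y : 2 <= x -> 2 <= y -> 2 <= x * y / (x + y - 2).
Proof.
move=> x2 y2; rewrite ler_pdivlMr; last lra.
rewrite -subr_ge0.
have -> : x * y - 2 * (x + y - 2) = (x - 2) * (y - 2) by ring.
by rewrite mulr_ge0; lra.
Qed.

(** The tangent line of [u ^+ 6] at 1: dividing the difference by
    [(u - 1) ^+ 2] leaves a cofactor with positive coefficients. *)
Lemma bernoulli6 u : 0 <= u -> 6 * u - 5 <= u ^+ 6 ?= iff (u == 1).
Proof.
move=> u0; set q := u ^+ 4 + 2 * u ^+ 3 + 3 * u ^+ 2 + 4 * u + 5.
have q0 : 0 < q.
  by have [] := (exprn_ge0 4 u0, exprn_ge0 3 u0); have := exprn_ge0 2 u0; rewrite /q; lra.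
have e : u ^+ 6 - (6 * u - 5) = (u - 1) ^+ 2 * q by rewrite /q; ring.
split; first by rewrite -subr_ge0 e mulr_ge0 ?sqr_ge0 // ltW.
by rewrite eq_sym -subr_eq0 e mulf_eq0 (gt_eqF q0) orbF sqrf_eq0 subr_eq0.
Qed.

(** The squared lower bound for an edge at a leaf, with the factor
    [(8 / 7) ^+ 6] cancelled. The linear bound on the sixth power is sharp only
    at [k = 8]; it also gives the value 9 at [k = 7], where strictness comes
    from the Bernoulli inequality itself. *)
Lemma pendent_term_ge9 (k : nat) : (2 <= k)%N ->
  9 <= (7 * k%:R / (8 * (k%:R - 1))) ^+ 6 * (k%:R + 1) ?= iff (k == 8) :> R.
Proof.
move=> k2.
have y2 : 2 <= k%:R :> R by rewrite ler_nat.
set y : R := k%:R in y2 *; set u := _ / _.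
have z0 : 0 < y - 1 by lra.
have u0 : 0 <= u by rewrite /u divr_ge0 //; lra.
have eu : (6 * u - 5) * (y + 1) = 9 + (y - 8) * (y - 7) / (4 * (y - 1)).
  by rewrite /u; field; lra.
have u1 : (u == 1) = (k == 8).
  rewrite /u -(eqr_nat R k 8) -/y; apply/eqP/eqP => [|->]; last by field.
  by move/(canRL (mulfVK _)) => h; have := h ltac:(lra); lra.
have prod0 : 0 <= (y - 8) * (y - 7) / (4 * (y - 1)).
  rewrite divr_ge0 //; last lra.
  have [k8|k8] := leqP 8 k.
    have : 8 <= y by rewrite ler_nat.
    by move=> ?; rewrite mulr_ge0 //; lra.
  have : y <= 7 by rewrite ler_nat -ltnS.
  by move=> ?; rewrite mulr_le0 //; lra.
have [b be] := bernoulli6 u0.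
(* Equality in the product forces equality in the Bernoulli bound, since
   [prod0] already makes the linear part at least 9. *)
split; first by rewrite (le_trans _ (ler_wpM2r _ b)) ?eu //; lra.
rewrite -u1 -be; apply/eqP/eqP => [e|e]; last first.
  move/eqP: e; rewrite be => /eqP e; rewrite e expr1n.
  by move/eqP: e; rewrite u1 /y => /eqP ->; ring.
apply/le_anti; rewrite b /= -(ler_pM2r (_ : 0 < y + 1)); last lra.
by rewrite -e eu lerDl.
Qed.

Lemma edge_term_lower (i j : nat) : (0 < i)%N -> (2 <= j)%N ->
  1536 / 343 * (1 / Num.sqrt (i%:R + j%:R))
    <= (i%:R * j%:R / (i%:R + j%:R - 2)) ^+ 3 ?= iff (i == 1) && (j == 8) :> R.
Proof.
move=> i0 j2.
have x1 : 1 <= i%:R :> R by rewrite ler1n.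
have y2 : 2 <= j%:R :> R by rewrite ler_nat.
have w0 : 0 <= i%:R * j%:R / (i%:R + j%:R - 2) :> R.
  by rewrite divr_ge0 ?mulr_ge0 //; lra.
apply: leif_div_sqrt; rewrite ?exprn_ge0 //; try lra.
rewrite -exprM.
have [->|i1] /= := eqVneq i 1%N.
  have [le eq] := pendent_term_ge9 j2; rewrite -eq.
  set y : R := j%:R in y2 le eq *.
  have -> : (1536 / 343) ^+ 2 = (8 / 7) ^+ 6 * 9 :> R by field.
  have -> : (1 * y / (1 + y - 2)) ^+ (3 * 2) * (1 + y)
    = (8 / 7) ^+ 6 * ((7 * y / (8 * (y - 1))) ^+ 6 * (y + 1)).
    by field; lra.
  split; first by rewrite ler_pM2l // exprn_gt0 // divr_gt0.
  by apply/inj_eq/mulfI; rewrite expf_neq0 // lt0r_neq0 // divr_gt0.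
have x2 : 2 <= i%:R :> R by rewrite ler_nat ltn_neqAle eq_sym i1.
have w2 := zagreb_ratio_ge2 x2 y2.
have w6 : 64 <= (i%:R * j%:R / (i%:R + j%:R - 2)) ^+ 6 :> R.
  have -> : 64 = 2 ^+ 6 :> R by ring.
  by apply: lerXn2r; rewrite ?nnegrE.
suff lt : (1536 / 343) ^+ 2 <
   (i%:R * j%:R / (i%:R + j%:R - 2)) ^+ 6 * (i%:R + j%:R) :> R.
  by split; [exact: ltW | rewrite lt_eqF].
(* The ratio is at least 2 and the degree sum at least 4. *)
apply: (@lt_le_trans _ _ (64 * 4)); first by lra.
by apply: ler_pM => //; lra.
Qed.

Lemma edge_term_upper (i j d : nat) :
    (0 < i <= d)%N -> (2 <= j <= d)%N ->
  (i%:R * j%:R / (i%:R + j%:R - 2)) ^+ 3 <=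
    Num.sqrt (d%:R ^+ 13) / (Num.sqrt 32 * (d%:R - 1) ^+ 3)
      * (1 / Num.sqrt (i%:R + j%:R)) ?= iff (i == d) && (j == d) :> R.
Proof.
move=> /andP[i0 id] /andP[j2 jd].
have x1 : 1 <= i%:R :> R by rewrite ler1n.
have y2 : 2 <= j%:R :> R by rewrite ler_nat.
have xm : i%:R <= d%:R :> R by rewrite ler_nat.
have ym : j%:R <= d%:R :> R by rewrite ler_nat.
rewrite -(eqr_nat R i d) -(eqr_nat R j d).
set x : R := i%:R in x1 xm *; set y : R := j%:R in y2 ym *.
set m : R := d%:R in xm ym *.
have w0 : 0 < x * y / (x + y - 2) by rewrite divr_gt0 ?mulr_gt0 //; lra.
have sd0 : 0 < Num.sqrt 32 * (m - 1) ^+ 3.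
  by rewrite mulr_gt0 ?sqrtr_gt0 ?exprn_gt0 //; lra.
apply: geif_div_sqrt; [|lra|by rewrite exprn_ge0 // ltW|].
  by rewrite divr_ge0 ?sqrtr_ge0 // ltW.
have -> : (Num.sqrt (m ^+ 13) / (Num.sqrt 32 * (m - 1) ^+ 3)) ^+ 2
    = (m ^+ 2 / (2 * (m - 1))) ^+ 6 * (2 * m).
  rewrite expr_div_n exprMn !sqr_sqrtr ?exprn_ge0 //.
  by field; lra.
rewrite -exprM.
have le6 : (x * y / (x + y - 2)) ^+ (3 * 2) <= (m ^+ 2 / (2 * (m - 1))) ^+ 6.
  apply: lerXn2r; rewrite ?nnegrE ?divr_ge0 ?sqr_ge0 ?mulr_ge0 //; try lra.
  by apply: zagreb_ratio_le_max; lra.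
have W6 : 0 < (m ^+ 2 / (2 * (m - 1))) ^+ 6.
  by apply: lt_le_trans le6; rewrite exprn_gt0.
have [/andP[/eqP -> /eqP ->]|ne] := boolP ((x == m) && (y == m)).
  have -> : (m * m / (m + m - 2)) ^+ (3 * 2) * (m + m)
      = (m ^+ 2 / (2 * (m - 1))) ^+ 6 * (2 * m) by field; lra.
  exact/leif_refl.
have lt : x + y < 2 * m.
  rewrite lt_neqAle (_ : _ <= _); last lra.
  rewrite andbT; apply: contra ne => /eqP e.
  by apply/andP; split; apply/eqP; lra.
suff lt' : (x * y / (x + y - 2)) ^+ (3 * 2) * (x + y)
    < (m ^+ 2 / (2 * (m - 1))) ^+ 6 * (2 * m).
  by split; [exact: ltW | rewrite lt_eqF].
apply: (@le_lt_trans _ _ ((m ^+ 2 / (2 * (m - 1))) ^+ 6 * (x + y))).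
  by rewrite ler_wpM2r //; lra.
by rewrite ltr_pM2l.
Qed.
End EdgeTerms.

(** * Degrees in connected graphs, stars and complete graphs *)

Section Graphs.
Implicit Types G H : sgraph.

Lemma edgesP G (e : {set G}) :
  reflect (exists v w : G, adj v w /\ e = [set v; w]) (e \in edges G).
Proof.
apply: (iffP imsetP) => [[[v w]]|[v [w [vw ->]]]].
  by rewrite inE /= => vw ->; exists v, w.
by exists (v, w); rewrite ?inE.
Qed.

Lemma adj_neq G (v w : G) : adj v w -> v != w.
Proof. by apply: contraL => /eqP ->; rewrite adj_irrefl. Qed.

Lemma degree_gt0 G (v w : G) : adj v w -> (0 < degree v)%N.
Proof. by move=> vw; apply/card_gt0P; exists w; rewrite inE. Qed.

Lemma neighbours_sub G (v : G) : [set w | adj v w] \subset [set~ v].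
Proof. by apply/subsetP=> w; rewrite !inE eq_sym => /adj_neq. Qed.

Lemma degree_le G (v : G) : (degree v <= #|G|.-1)%N.
Proof. by rewrite -(cardsC1 v) subset_leq_card ?neighbours_sub. Qed.

Lemma degree_max_adj G (v w : G) : degree v = #|G|.-1 -> v != w -> adj v w.
Proof.
move=> dv vw; have /eqP e : [set w | adj v w] == [set~ v].
  by rewrite eqEcard neighbours_sub cardsC1 -dv leqnn.
by have := in_setC1 w v; rewrite -e inE eq_sym vw.
Qed.

Lemma degree1_adj_unique G (v w x : G) : degree v = 1%N -> adj v w -> adj v x -> x = w.
Proof.
move=> /eqP /cards1P[y e] vw vx.
have : w \in [set w | adj v w] by rewrite inE.
have : x \in [set w | adj v w] by rewrite inE.
by rewrite e !inE => /eqP -> /eqP ->.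
Qed.

(** Induction along a path; the global structure of extremal graphs is read off
    from the neighbourhood of one vertex in this way. *)
Lemma connected_closed G (A : {pred G}) v :
    connected_graph G -> v \in A -> (forall x y, adj x y -> x \in A -> y \in A) ->
  forall w, w \in A.
Proof.
move=> [_ conn] vA cl w; have /connectP[p] := conn v w.
elim: p v vA => [|x p IH] v vA /=; first by move=> _ ->.
by move=> /andP[vx px]; apply: IH => //; apply: cl vx vA.
Qed.

Lemma exists_adj G (v : G) : connected_graph G -> (1 < #|G|)%N -> exists w, adj v w.
Proof.
move=> conn G1; apply/existsP; apply: contraLR G1 => /existsPn no.
rewrite -leqNgt -(cards1 v) -cardsT; apply/subset_leq_card/subsetP => w _.
apply: (@connected_closed _ [set v] v) => // [|x y]; rewrite !inE //.
by move=> xy /eqP xv; move: (no y); rewrite -xv xy.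
Qed.

(** An edge with two ends of degree 1 is a whole connected component. This
    keeps the denominator [i + j - 2] of the Zagreb term away from 0. *)
Lemma edge_degree_gt1 G (v w : G) : connected_graph G -> (2 < #|G|)%N -> adj v w ->
  (1 < degree v)%N || (1 < degree w)%N.
Proof.
move=> conn G2 vw; have wv : adj w v by rewrite adj_sym.
apply: contraLR G2; rewrite negb_or -!leqNgt => /andP[v1 w1].
have {}v1 : degree v = 1%N by apply/eqP; rewrite eqn_leq v1 (degree_gt0 vw).
have {}w1 : degree w = 1%N by apply/eqP; rewrite eqn_leq w1 (degree_gt0 wv).
have -> : 2%N = #|[set v; w]| by rewrite cards2 adj_neq.
rewrite -cardsT; apply/subset_leq_card/subsetP => u _.
apply: (@connected_closed _ [set v; w] v) => // [|x y]; rewrite !inE ?eqxx //.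
move=> xy /orP[] /eqP ex; move: xy; rewrite ex.
  by move=> /(degree1_adj_unique v1 vw) ->; rewrite eqxx orbT.
by move=> /(degree1_adj_unique w1 wv) ->; rewrite eqxx.
Qed.

Lemma degree_iso G H (f : G -> H) (v : G) : bijective f ->
  (forall v w, adj (f v) (f w) = adj v w) -> degree (f v) = degree v.
Proof.
move=> bf fadj; rewrite /degree -(card_imset _ (bij_inj bf)).
have [g fK gK] := bf.
apply/eq_card => y; rewrite inE; apply/idP/imsetP => [h|[w]].
  by exists (g y); rewrite ?gK // inE -fadj gK.
by rewrite inE => vw ->; rewrite fadj.
Qed.

Lemma complete_graphP n G : #|G| = n -> 
  graph_iso G (complete_graph n) <-> forall v w : G, v != w -> adj v w.
Proof.
move=> cG; split=> [[f bf fadj] v w vw|all_adj].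
  by rewrite -fadj /= /complete_adj (inj_eq (bij_inj bf)).
exists (cast_ord cG \o enum_rank) => [|v w /=].
  apply: bij_comp; last exact: enum_rank_bij.
  by exists (cast_ord (esym cG)); [exact: cast_ordK | exact: cast_ordKV].
rewrite /complete_adj (inj_eq (@cast_ord_inj _ _ _)) (inj_eq enum_rank_inj).
by apply/idP/idP => [/all_adj//|]; apply: adj_neq.
Qed.

Lemma star_graphP k G : #|G| = k.+1 ->
  graph_iso G (star_graph k) <->
  exists c : G, forall v w, adj v w = (v == c) (+) (w == c).
Proof.
move=> cG; split=> [[f bf fadj]|[c cadj]].
  have [g fK gK] := bf; exists (g ord0) => v w.
  by rewrite -fadj /= /star_adj -!(can_eq fK) gK.
pose h := cast_ord cG \o enum_rank.
have bh : bijective h.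
  apply: bij_comp; last exact: enum_rank_bij.
  by exists (cast_ord (esym cG)); [exact: cast_ordK | exact: cast_ordKV].
(* Any bijection onto the ordinals will do once a transposition has moved the
   image of the centre to [ord0]. *)
exists (tperm (h c) ord0 \o h) => [|v w /=].
  by apply: bij_comp bh; exists (tperm (h c) ord0); exact: tpermK.
have f0 u : (tperm (h c) ord0 (h u) == ord0) = (u == c).
  by rewrite -{2}(tpermL (h c) ord0) (inj_eq perm_inj) (inj_eq (bij_inj bh)).
by rewrite cadj /star_adj -!f0.
Qed.

Lemma star_degree k (i : star_graph k) :
  degree i = if i == ord0 then k else 1%N.
Proof.
rewrite /degree; have [->|i0] := eqVneq i ord0.
  rewrite -[RHS]/(k.+1.-1) -[in RHS](card_ord k.+1) -(cardsC1 (ord0 : 'I_k.+1)).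
  by apply/eq_card => j; rewrite !inE /= /star_adj eqxx.
rewrite -[RHS](cards1 (ord0 : 'I_k.+1)).
by apply/eq_card => j; rewrite !inE /= /star_adj (negPf i0).
Qed.

(** A vertex [c] of degree [k] has only neighbours of degree 1, so [c] and its
    neighbours are closed under adjacency and make up the whole graph. The
    condition [1 < k] separates centre from leaf. *)
Lemma star_of_edge_degrees k G : (1 < k)%N -> connected_graph G -> (1 < #|G|)%N ->
  (forall v w : G, adj v w ->
    (degree v == 1%N) && (degree w == k) || (degree v == k) && (degree w == 1%N)) ->
  graph_iso G (star_graph k).
Proof.
move=> k1 conn G1 deg1k.
have [c dc] : exists c : G, degree c = k.
  have [] := conn; rewrite lt0n => /existsP[v _] _.
  have [w /deg1k] := exists_adj v conn G1.
  by case/orP => /andP[/eqP ? /eqP ?]; [exists w | exists v].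
have leaf v : adj c v -> degree v = 1%N.
  by move/deg1k; rewrite dc eqxx (gtn_eqF k1) /= => /eqP.
have ngb : forall v, v \in [pred v | (v == c) || adj c v].
  apply: (connected_closed (v := c) conn) => [|x y xy]; rewrite !inE ?eqxx //.
  case/orP => [/eqP <-|cx]; first by rewrite xy orbT.
  have xc : adj x c by rewrite adj_sym.
  by rewrite (degree1_adj_unique (leaf _ cx) xc xy) eqxx.
have cadj v w : adj v w = (v == c) (+) (w == c).
  have [->|vc] := eqVneq v c.
    have [->|wc] := eqVneq w c; first by rewrite adj_irrefl.
    by have := ngb w; rewrite inE (negPf wc).
  have cv : adj c v by have := ngb v; rewrite inE (negPf vc).
  have vc' : adj v c by rewrite adj_sym.
  rewrite addFb; apply/idP/eqP => [|->//].
  exact: degree1_adj_unique (leaf _ cv) vc'.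
apply/star_graphP; last by exists c.
have -> : k = #|[set~ c]|.
  rewrite -dc /degree; apply/eq_card => v; rewrite !inE cadj eqxx.
  by rewrite addTb.
by rewrite cardsC1 prednK // (ltn_trans _ G1).
Qed.

Lemma star_edge_degrees k G : graph_iso G (star_graph k) ->
  forall v w : G, adj v w ->
    (degree v == 1%N) && (degree w == k) || (degree v == k) && (degree w == 1%N).
Proof.
move=> [f bf fadj] v w; rewrite -fadj -!(degree_iso _ bf fadj) !star_degree /= /star_adj.
by case: ifP; case: ifP => _ _ //=; rewrite !eqxx ?orbT.
Qed.

Lemma complete_iff_edge_degrees G : connected_graph G -> (1 < #|G|)%N ->
  graph_iso G (complete_graph #|G|) <->
  forall v w : G, adj v w -> (degree v == #|G|.-1) && (degree w == #|G|.-1).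
Proof.
move=> conn G1; rewrite complete_graphP //; split=> [all_adj v w _|deg v w vw].
  have dmax (u : G) : degree u == #|G|.-1.
    rewrite /degree -(cardsC1 u); apply/eqP/eq_card => x; rewrite !inE.
    by apply/idP/idP => [/adj_neq|]; rewrite eq_sym // => /all_adj.
  by rewrite !dmax.
have [x /deg /andP[/eqP dv _]] := exists_adj v conn G1.
exact: degree_max_adj dv vw.
Qed.

End Graphs.

(** * From edges to sums over edges *)

Section EdgeSums.
Variables (R : rcfType) (G : sgraph).

(** A termwise inequality with equality case [P] sums up to an inequality whose
    equality case is [P] on every edge, because no slack can cancel. *)
Lemma edge_sum_leif (E1 E2 : {set G} -> R) (P : rel nat) :
    (forall v w : G, adj v w ->
       E1 [set v; w] <= E2 [set v; w] ?= iff P (degree v) (degree w)) ->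
  \sum_(e in edges G) E1 e <= \sum_(e in edges G) E2 e /\
  (\sum_(e in edges G) E1 e = \sum_(e in edges G) E2 e <->
   forall v w : G, adj v w -> P (degree v) (degree w)).
Proof.
move=> termP.
have leE e : e \in edges G -> E1 e <= E2 e ?= iff (E1 e == E2 e).
  by case/edgesP => v [w [/termP [le _] ->]]; split.
have [le eq] := leif_sum leE; split=> //; split=> [/eqP|allP].
  rewrite eq => /forall_inP h v w vw.
  by have [_ <-] := termP v w vw; apply: h; apply/edgesP; exists v, w.
apply: eq_bigr => e /edgesP[v [w [vw ->]]].
by apply/eqP; have [_ ->] := termP v w vw; apply: allP.
Qed.

(** Edge terms depend on the unordered pair only, so the end of degree at least
    2, which always exists, can be taken to be the second one. *)
Lemma edge_leif (E1 E2 : {set G} -> R) (P : rel nat) :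
    connected_graph G -> (2 < #|G|)%N -> symmetric P ->
    (forall v w : G, adj v w -> (1 < degree w)%N ->
       E1 [set v; w] <= E2 [set v; w] ?= iff P (degree v) (degree w)) ->
  forall v w : G, adj v w ->
    E1 [set v; w] <= E2 [set v; w] ?= iff P (degree v) (degree w).
Proof.
move=> conn G2 symP term v w vw.
case/orP: (edge_degree_gt1 conn G2 vw) => deg2; last exact: term.
by rewrite setUC symP; apply: term => //; rewrite adj_sym.
Qed.

Lemma sum_edge (F : G -> R) v w : adj v w -> \sum_(u in [set v; w]) F u = F v + F w.
Proof. by move/adj_neq => vw; rewrite big_setU1 ?inE //= big_set1. Qed.

Lemma prod_edge (F : G -> R) v w : adj v w -> \prod_(u in [set v; w]) F u = F v * F w.
Proof. by move/adj_neq => vw; rewrite big_setU1 ?inE //= big_set1. Qed.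

End EdgeSums.

Theorem theorem2p14 (R : rcfType) (n : nat) (G : sgraph)
    (hn : (3 <= n)%N) (hcard : #|G| = n) (hconn : connected_graph G) :
  (1536 / 343 * sum_connectivity R G <= augmented_zagreb R G
   /\ augmented_zagreb R G
      <= Num.sqrt ((n%:R - 1) ^+ 13) / (Num.sqrt 32 * (n%:R - 2) ^+ 3)
         * sum_connectivity R G)
  /\ (1536 / 343 * sum_connectivity R G = augmented_zagreb R G
      <-> graph_iso G (star_graph 8))
  /\ (augmented_zagreb R G
      = Num.sqrt ((n%:R - 1) ^+ 13) / (Num.sqrt 32 * (n%:R - 2) ^+ 3)
        * sum_connectivity R G
      <-> graph_iso G (complete_graph n)).
Proof.
have G2 : (2 < #|G|)%N by rewrite hcard.
have G1 : (1 < #|G|)%N by apply: ltnW.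
rewrite /sum_connectivity /augmented_zagreb !mulr_sumr.
pose star_pair k : rel nat :=
  fun i j => (i == 1%N) && (j == k) || (i == k) && (j == 1%N).
have sym_star k : symmetric (star_pair k).
  by move=> i j; rewrite /star_pair orbC [(j == _) && _]andbC [(j == k) && _]andbC.
pose top_pair d : rel nat := fun i j => (i == d) && (j == d).
have sym_top d : symmetric (top_pair d) by move=> i j; rewrite /top_pair andbC.
pose SC (e : {set G}) : R := 1 / Num.sqrt (\sum_(v in e) (degree v)%:R).
pose AZ (e : {set G}) : R :=
  ((\prod_(v in e) (degree v)%:R) / ((\sum_(v in e) (degree v)%:R) - 2)) ^+ 3.
have SCe v w : adj v w -> SC [set v; w] = 1 / Num.sqrt ((degree v)%:R + (degree w)%:R).
  by move=> vw; rewrite /SC sum_edge.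
have AZe v w : adj v w -> AZ [set v; w] =
    ((degree v)%:R * (degree w)%:R / ((degree v)%:R + (degree w)%:R - 2)) ^+ 3.
  by move=> vw; rewrite /AZ sum_edge // prod_edge.
have [||lower lower_eq] := edge_sum_leif (edge_leif (P := star_pair 8)
  (E1 := fun e => 1536 / 343 * SC e) (E2 := AZ) hconn G2 _ _).
- exact: sym_star.
- move=> v w vw w2; rewrite SCe // AZe //.
  have [le eq] := edge_term_lower R (degree_gt0 vw) w2; split=> //.
  by rewrite eq /star_pair (gtn_eqF w2) andbF orbF.
have [||upper upper_eq] := edge_sum_leif (edge_leif (P := top_pair n.-1)
  (E1 := AZ) (E2 := fun e => Num.sqrt ((n%:R - 1) ^+ 13)
     / (Num.sqrt 32 * (n%:R - 2) ^+ 3) * SC e) hconn G2 _ _).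
- exact: sym_top.
- move=> v w vw w2; rewrite SCe // AZe //.
  have d_le (u : G) : (degree u <= n.-1)%N by rewrite -hcard degree_le.
  have -> : n%:R - 2 = n.-1%:R - 1 :> R.
    by rewrite -[n in LHS](ltn_predK hn) -natr1; ring.
  have -> : n%:R - 1 = n.-1%:R :> R.
    by rewrite -[n in LHS](ltn_predK hn) -natr1; ring.
  by apply: edge_term_upper; rewrite ?d_le ?andbT ?(degree_gt0 vw).
split; first by split.
split; [apply: (iff_trans lower_eq) | apply: (iff_trans upper_eq)].
  split=> [|/star_edge_degrees]; last exact.
  exact: star_of_edge_degrees.
by apply: iff_sym; rewrite -hcard; apply: complete_iff_edge_degrees.
Qed.
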